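(* Let $\lambda=(\lambda_1,\ldots,\lambda_{l})$ be a partition with $l=l(\lambda)$ positive parts, and let $p$ be a positive integer. Write the Taylor expansion at infinity (expansion in descending powers of $z$) \[(z)_p\,\frac{F(z-p;\lambda)}{F(z;\lambda)}=\sum_{r\ge -p} C_r(\lambda;p)\,z^{-r}.\] Then for every integer $r\ge 0$, \[C_{r+1}(\lambda;p)=-p\sum_{k=1}^{l(\lambda)} d_\lambda(k,p)\,(\lambda_k-k)^r.\]
   Context: For an indeterminate $z$ and a positive integer $p$, $(z)_p=z(z-1)\cdots(z-p+1)$ is the lowering factorial. The Frobenius function of a partition $\lambda$ is $F(z;\lambda)=\prod_{i\ge 1}\frac{z-\lambda_i+i}{z+i}$ (only the factors with $\lambda_i>0$, i.e. $i\le l(\lambda)$, differ from $1$). For $1\le k\le l(\lambda)$ and a positive integer $p$, \[d_\lambda(k,p)=(\lambda_k+l(\lambda)-k)_p\prod_{i=1,\,i\neq k}^{l(\lambda)}\frac{\lambda_k-\lambda_i+i-k-p}{\lambda_k-\lambda_i+i-k},\] where $(\lambda_k+l(\lambda)-k)_p$ is the lowering factorial (equal to $\frac{(\lambda_k+l(\lambda)-k)!}{(\lambda_k+l(\lambda)-k-p)!}$ when $\lambda_k+l(\lambda)-k\ge p$). *)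

(* Defs.v *)
From HB Require Import structures.
From mathcomp Require Import all_boot all_order all_algebra.

Set Implicit Arguments.
Unset Strict Implicit.
Unset Printing Implicit Defensive.

Import GRing.Theory Num.Theory.
Local Open Scope ring_scope.

Definition is_partition (la : seq nat) : bool :=
  sorted geq la && (0%N \notin la).

(* The part la_i, numbered from 1, so that [la`_i] with ssreflect's 0-based
   indexing is la_{i+1}. *)
Definition part (la : seq nat) (i : nat) : nat := nth 0%N la i.-1.

Definition lowfact (A : pzRingType) (z : A) (p : nat) : A :=
  \prod_(0 <= j < p) (z - j%:R).

(* The factors with i > size la equal 1 when z + i is invertible, so the
   infinite product is truncated at the number of parts. *)
Definition frobenius_fun (A : unitRingType) (z : A) (la : seq nat) : A :=
  \prod_(1 <= i < (size la).+1) ((z - (part la i)%:R + i%:R) / (z + i%:R)).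

Definition dcoef (K : unitRingType) (la : seq nat) (k p : nat) : K :=
  lowfact ((part la k)%:R + (size la)%:R - k%:R) p *
  \prod_(1 <= i < (size la).+1 | i != k)
    (((part la k)%:R - (part la i)%:R + i%:R - k%:R - p%:R) /
     ((part la k)%:R - (part la i)%:R + i%:R - k%:R)).

Section ExpansionAtInfinity.

Local Notation "x %:F" := (@FracField.tofrac _ x).

Variable K : fieldType.
Implicit Types (f : {fraction {poly K}}) (C : int -> K).

Definition zvar : {fraction {poly K}} := ('X : {poly K})%:F.

(* f = O(z^{-k}) at infinity, i.e. deg a - deg b <= - k for f = a / b; for
   f <> 0 the difference does not depend on the choice of a and b, and f = 0
   qualifies for every k since b may be taken of arbitrarily large degree. *)
Definition bigO_infty (k : int) f : Prop :=
  exists a b : {poly K},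
    [/\ b != 0, f = a%:F / b%:F & (size a)%:Z + k <= (size b)%:Z].

(* f = \sum_(r >= m) C_r z^{-r}, the sum converging for the z^{-1}-adic
   topology: f minus the sum of its first n terms is O(z^{-(m + n)}). Only the
   values of C at integers r >= m are relevant. *)
Definition expansion_infty (m : int) f C : Prop :=
  forall n : nat,
    bigO_infty (m + n%:Z)
      (f - \sum_(0 <= j < n) ((C (m + j%:Z))%:P)%:F * zvar ^ (- (m + j%:Z))).

End ExpansionAtInfinity.

Arguments zvar K : clear implicits.
Arguments dcoef K la k p : clear implicits.

(* Main.v *)
(* Writing a_i = la_i - i and l for the number of parts, the denominators of the
   Frobenius functions telescope against (z)_p, so that
     f = (z + l)_p \prod_i (z - p - a_i) / (z - a_i).
   The a_i are pairwise distinct, hence f is a polynomial of degree p plus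
   \sum_k R_k / (z - a_k), where R_k = - p d(k, p) is the residue at a_k.
   Expanding c / (z - a) = \sum_(r >= 0) c a^r z^(- r - 1) gives the
   coefficients. *)
Require Import Defs.
From mathcomp Require Import all_boot all_order all_algebra.
From mathcomp Require Import zify ring.
Set Implicit Arguments.
Unset Strict Implicit.
Unset Printing Implicit Defensive.
Import GRing.Theory Num.Theory.
Local Open Scope ring_scope.

Local Notation "x %:F" := (@FracField.tofrac _ x).

(** * Order at infinity of rational functions *)

Section BigO.

Variable K : fieldType.
Implicit Types (f g : {fraction {poly K}}) (a b : {poly K}) (k : int).

Lemma bigO_infty0 k : bigO_infty k (0 : {fraction {poly K}}).
Proof.
exists 0, 'X^(`|k|%N); split; first by rewrite -size_poly_gt0 size_polyXn.
  by rewrite rmorph0 mul0r.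
by rewrite size_poly0 size_polyXn; lia.
Qed.

Lemma bigO_inftyD k f g : bigO_infty k f -> bigO_infty k g -> bigO_infty k (f + g).
Proof.
move=> [a [b [b0 -> ab]]] [c [d [d0 -> cd]]].
have [->|a0] := eqVneq a 0.
  by rewrite rmorph0 mul0r add0r; exists c, d.
have [->|c0] := eqVneq c 0.
  by rewrite rmorph0 mul0r addr0; exists a, b.
exists (a * d + c * b), (b * d); split; first by rewrite mulf_neq0.
  by rewrite addf_div ?tofrac_eq0 // rmorphD !rmorphM.
have := size_polyD (a * d) (c * b).
rewrite !size_mul //.
move: a0 b0 c0 d0 ab cd; rewrite -!size_poly_gt0.
move: (size a) (size b) (size c) (size d) (size (a * d + c * b)) => na nb nc nd n.
lia.
Qed.

Lemma bigO_inftyN k f : bigO_infty k f -> bigO_infty k (- f).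
Proof.
by move=> [a [b [b0 -> ab]]]; exists (- a), b; rewrite rmorphN mulNr size_polyN.
Qed.

(** Cross-multiplying two representations of a nonzero fraction shows that they have the same degree
    difference, so the existential bound can be tested on any one of them. *)
Lemma bigO_infty_size k a b :
  a != 0 -> b != 0 -> bigO_infty k (a%:F / b%:F) -> (size a)%:Z + k <= (size b)%:Z.
Proof.
move=> a0 b0 [c [d [d0 /eqP]]].
rewrite eqr_div ?tofrac_eq0 // -!rmorphM /= tofrac_eq => /eqP E cd.
have c0 : c != 0.
  by apply: contraNneq (mulf_neq0 a0 d0) => c0; rewrite E c0 mul0r.
move/(congr1 (fun q : {poly K} => size q)): E; rewrite !size_mul //.
move: a0 b0 c0 d0 cd; rewrite -!size_poly_gt0.
move: (size a) (size b) (size c) (size d) => na nb nc nd.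
lia.
Qed.

Lemma zvar_neq0 : zvar K != 0.
Proof. by rewrite tofrac_eq0 polyX_eq0. Qed.

(** The sign of [k] decides whether the power of z goes to the denominator or to the numerator. The
    size equation asks for [c != 0] because the zero polynomial has size 0. *)
Lemma monomial_frac (c : K) k : exists a b,
  [/\ b != 0, (c%:P)%:F * zvar K ^ (- k) = a%:F / b%:F,
      (a == 0) = (c == 0) & c != 0 -> (size a)%:Z + k = (size b)%:Z].
Proof.
case: (lerP 0 k) => k0.
  exists c%:P, 'X^(`|k|%N); split.
  - by rewrite -size_poly_gt0 size_polyXn.
  - by rewrite -[in LHS](gez0_abs k0) -exprnN rmorphXn.
  - by rewrite polyC_eq0.
  - by move=> c0; rewrite size_polyC c0 size_polyXn; lia.
exists (c%:P * 'X^(`|k|%N)), 1; split.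
- exact: oner_neq0.
- have -> : - k = `|k|%N%:Z by lia.
  by rewrite -exprnP rmorphM rmorphXn rmorph1 divr1.
- by rewrite mulf_eq0 polyC_eq0 expf_eq0 polyX_eq0 andbF orbF.
- move=> c0; rewrite mul_polyC size_scale // size_polyXn size_poly1; lia.
Qed.

Lemma bigO_monomial (c : K) k j : j <= k -> bigO_infty j ((c%:P)%:F * zvar K ^ (- k)).
Proof.
move=> jk; have [->|c0] := eqVneq c 0.
  by rewrite rmorph0 mul0r; apply: bigO_infty0.
have [a [b [b0 -> _ /(_ c0) ab]]] := monomial_frac c k.
by exists a, b; split=> //; lia.
Qed.

(** A nonzero monomial has order exactly [k]; the uniqueness of coefficients rests on this. *)
Lemma bigO_monomial_eq0 (c : K) k :
  bigO_infty (k + 1) ((c%:P)%:F * zvar K ^ (- k)) -> c = 0.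
Proof.
have [a [b [b0 -> ac ab]]] := monomial_frac c k.
have [//|c0] := eqVneq c 0.
by move/bigO_infty_size => /(_ _ b0); rewrite ac => /(_ c0); have := ab c0; lia.
Qed.

End BigO.

(** One step of the geometric series with exact remainder, from 1/(x - a) = 1/x + a/(x (x - a)). *)
Lemma geometric_step (F : fieldType) (x a c : F) (n : nat) :
  x != 0 -> x - a != 0 ->
  c * a ^+ n / (x ^+ n * (x - a)) =
  c * a ^+ n * x ^- n.+1 + c * a ^+ n.+1 / (x ^+ n.+1 * (x - a)).
Proof.
by move=> x0 xa0; rewrite !exprS; field; rewrite x0 xa0 expf_neq0.
Qed.

(** * Expansions in descending powers of z *)

Section Expansion.

Variable K : fieldType.
Implicit Types (f g : {fraction {poly K}}) (m : int) (C : int -> K).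

Lemma expansion_infty0 m : expansion_infty m (0 : {fraction {poly K}}) (fun=> 0).
Proof.
move=> n; rewrite big1 ?subr0; first exact: bigO_infty0.
by move=> i _; rewrite rmorph0 mul0r.
Qed.

Lemma expansion_inftyD m f g C D :
  expansion_infty m f C -> expansion_infty m g D ->
  expansion_infty m (f + g) (fun i => C i + D i).
Proof.
move=> fC gD n; have := bigO_inftyD (fC n) (gD n); congr bigO_infty.
rewrite addrACA -opprD -big_split /=; congr (_ - _).
by apply: eq_bigr => i _; rewrite !rmorphD mulrDl.
Qed.

Lemma expansion_infty_sum m (I : Type) (r : seq I)
    (f : I -> {fraction {poly K}}) (C : I -> int -> K) :
  (forall i, expansion_infty m (f i) (C i)) ->
  expansion_infty m (\sum_(i <- r) f i) (fun j => \sum_(i <- r) C i j).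
Proof.
move=> fC; elim: r => [|i r IHr] n.
  rewrite big_nil; under eq_bigr do rewrite big_nil.
  exact: expansion_infty0.
have := expansion_inftyD (fC i) IHr n; congr bigO_infty.
by rewrite big_cons; congr (_ - _); apply: eq_bigr => j _; rewrite big_cons.
Qed.

Lemma expansion_infty_unique m f C D :
  expansion_infty m f C -> expansion_infty m f D ->
  forall n : nat, C (m + n%:Z) = D (m + n%:Z).
Proof.
move=> fC fD; elim/ltn_ind => n IHn; apply/eqP; rewrite -subr_eq0; apply/eqP.
(* Subtracting the truncations at [n.+1] terms cancels [f]; the first [n] terms agree by induction,
   so a single monomial of index [m + n] remains, bounded to order [m + n + 1]. *)
have := bigO_inftyD (bigO_inftyN (fC n.+1)) (fD n.+1).
rewrite opprB subrKA !big_nat_recr //=.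
rewrite [X in bigO_infty _ (X + _ - _)](_ : _ =
   \sum_(0 <= j < n) (D (m + j%:Z))%:P%:F * zvar K ^ (- (m + j%:Z))); last first.
  by apply: eq_big_nat => i /andP[_ /IHn ->].
set S := \sum_(0 <= j < n) _.
rewrite [S + _]addrC addrKA -mulrBl -!rmorphB /=.
by rewrite -addn1 PoszD addrA => /bigO_monomial_eq0.
Qed.

(** Here [h k] plays the tail made of the terms of index at least [k]. Peeling off one term at a
    time telescopes, so an expansion is proved by exhibiting its tails. *)
Lemma expansion_infty_remainder m f C (h : int -> {fraction {poly K}}) :
  h m = f -> (forall k, bigO_infty k (h k)) ->
  (forall k, h k = (C k)%:P%:F * zvar K ^ (- k) + h (k + 1)) ->
  expansion_infty m f C.
Proof.
move=> hm hO hS n; have -> : f - \sum_(0 <= j < n)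
    (C (m + j%:Z))%:P%:F * zvar K ^ (- (m + j%:Z)) = h (m + n%:Z); last exact: hO.
elim: n => [|n IHn]; first by rewrite big_nil subr0 addr0.
rewrite big_nat_recr //= opprD addrA IHn hS addrC addKr.
by rewrite -addn1 PoszD addrA.
Qed.

Lemma expansion_monomial m (c : K) k : m <= k ->
  expansion_infty m ((c%:P)%:F * zvar K ^ (- k)) (fun i => if i == k then c else 0).
Proof.
move=> mk; apply: (expansion_infty_remainder
  (h := fun i => if i <= k then (c%:P)%:F * zvar K ^ (- k) else 0)).
- by rewrite mk.
- by move=> i; case: ifP => [/bigO_monomial //|_]; apply: bigO_infty0.
move=> i; case: (ltrgtP i k) => [ik|ik|->].
- by rewrite ifT ?rmorph0 ?mul0r ?add0r //; lia.
- by rewrite ifF ?rmorph0 ?mul0r ?add0r //; lia.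
- by rewrite ifF ?addr0 //; lia.
Qed.

Lemma expansion_poly (p : nat) (S : {poly K}) : (size S <= p.+1)%N ->
  expansion_infty (- p%:Z) S%:F
    (fun i => \sum_(j < p.+1) if i == - (j : nat)%:Z then S`_j else 0).
Proof.
move=> sS.
have -> : S%:F = \sum_(j < p.+1) (S`_j)%:P%:F * zvar K ^ (- - (j : nat)%:Z).
  (* The sum is widened from [size S] to [p.+1] terms; the extra coefficients are the default 0 of
     [nth]. *)
  rewrite -[S in LHS]coefK (poly_def) (big_ord_widen _ (fun i => S`_i *: 'X^i) sS).
  rewrite big_mkcond rmorph_sum; apply: eq_bigr => j _.
  rewrite opprK -exprnP; case: ltnP => jS.
    by rewrite -mul_polyC rmorphM rmorphXn.
  by rewrite nth_default // !rmorph0 mul0r.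
apply: expansion_infty_sum => j; apply: expansion_monomial.
by have := ltn_ord j; lia.
Qed.

Lemma expansion_simple_pole m (c a : K) : m <= 1 ->
  expansion_infty m ((c%:P)%:F / ('X - a%:P)%:F)
    (fun i => if i is Posz j.+1 then c * a ^+ j else 0).
Proof.
move=> m1; have Xa0 := polyXsubC_eq0 a.
(* At index j + 1 the first j terms are gone and the tail is c a^j / (z^j (z - a)); at an index at
   most 0 it is still the whole fraction. *)
apply: (expansion_infty_remainder (h := fun i =>
  let n := if i is Posz j.+1 then j else 0%N in
  ((c * a ^+ n)%:P)%:F / ('X^n * ('X - a%:P))%:F)).
- have -> : (if m is Posz j.+1 then j else 0%N) = 0%N.
    by case: m m1 => [[|[|]]|].
  by rewrite /= !expr0 mulr1 mul1r.
- move=> i /=; set n := (X in 'X^X).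
  exists (c * a ^+ n)%:P, ('X^n * ('X - a%:P)); split=> //.
    by rewrite mulf_neq0 ?Xa0 // expf_neq0 ?polyX_eq0.
  rewrite size_Mmonic ?monicXsubC ?monic_neq0 ?monicXn // size_polyXn size_XsubC.
  by rewrite size_polyC; case: eqP => _; rewrite /n; case: i {n} => [[|j]|j]; lia.
case=> [[|j]|j] /=.
- by rewrite !rmorph0 mul0r add0r.
- rewrite addn1 -exprnN !rmorphM !rmorphXn !rmorphB /=.
  apply: geometric_step; first exact: zvar_neq0.
  by rewrite -rmorphB /= tofrac_eq0 Xa0.
- by rewrite rmorph0 mul0r add0r; case: j.
Qed.

End Expansion.

(** * Partial fractions with simple poles *)

Section PartialFractions.

Variables (K : fieldType) (I : eqType) (r : seq I) (a : I -> K).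
Hypotheses (r_uniq : uniq r) (a_inj : {in r &, injective a}).

(** Both sides have size at most [size r] and agree at the [size r] distinct points [a k]. *)
Lemma lagrange_interpolation (P : {poly K}) : (size P <= size r)%N ->
  P = \sum_(k <- r) (P.[a k] / \prod_(i <- r | i != k) (a k - a i)) *:
        \prod_(i <- r | i != k) ('X - (a i)%:P).
Proof.
move=> sP; apply/eqP; rewrite -subr_eq0; apply/eqP.
apply: (@roots_geq_poly_eq0 _ _ (map a r)).
- apply/allP => _ /mapP[j jr ->]; rewrite rootE hornerD hornerN horner_sum subr_eq0.
  apply/eqP; rewrite (bigD1_seq j) //= [X in _ + X]big1 ?addr0 => [|k kj]; last first.
    apply/eqP; rewrite hornerZ horner_prod mulf_eq0 prodf_seq_eq0 orbC.
    by apply/orP; left; apply/hasP; exists j;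
      rewrite //= eq_sym kj hornerXsubC subrr /=.
  rewrite hornerZ horner_prod; under [in X in _ = _ * X]eq_bigr do rewrite hornerXsubC.
  rewrite divfK // prodf_seq_neq0; apply/allP => i ir; apply/implyP => ij.
  by rewrite subr_eq0; apply: contra_neq ij => /a_inj->.
- by rewrite map_inj_in_uniq.
rewrite size_map (leq_trans (size_polyD _ _)) // geq_max sP size_polyN /=.
apply: (leq_trans (size_sum _ _ _)); apply/bigmax_leqP_seq => k kr _.
apply: (leq_trans (size_scale_leq _ _)).
(* Omitting [k] leaves one linear factor fewer than [size r], and a product of n such factors has
   size n + 1. *)
rewrite -big_filter size_prod_XsubC size_filter.
by have := count_predC (pred1 k) r; rewrite count_uniq_mem // kr /= => <-.
Qed.

(** Divide by [Q] and interpolate the remainder; since [Q] vanishes at each [a k], the remainder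
    takes the same values there as [P]. *)
Lemma partial_fractions (P : {poly K}) :
  let Q := \prod_(i <- r) ('X - (a i)%:P) in
  P%:F / Q%:F = (P %/ Q)%:F + \sum_(k <- r)
    ((P.[a k] / \prod_(i <- r | i != k) (a k - a i))%:P)%:F / ('X - (a k)%:P)%:F.
Proof.
move=> Q; have Q0 : Q != 0 by rewrite monic_neq0 ?monic_prod_XsubC.
have QF0 : Q%:F != 0 by rewrite tofrac_eq0.
have sR : (size (P %% Q)%R <= size r)%N.
  by have := ltn_modpN0 P Q0; rewrite /Q size_prod_XsubC.
rewrite {1}(divp_eq P Q) rmorphD rmorphM mulrDl mulfK //; congr (_ + _).
rewrite (lagrange_interpolation sR) rmorph_sum mulr_suml.
apply: eq_big_seq => k kr.
have Qk : Q = ('X - (a k)%:P) * \prod_(i <- r | i != k) ('X - (a i)%:P).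
  by rewrite /Q (bigD1_seq k).
have Qak : Q.[a k] = 0 by rewrite Qk hornerM hornerXsubC subrr mul0r.
have -> : (P %% Q).[a k] = P.[a k].
  by rewrite [in RHS](divp_eq P Q) hornerD hornerM Qak mulr0 add0r.
move: Q0; rewrite Qk mulf_eq0 negb_or => /andP[X0 D0].
have DF0 := D0; rewrite -tofrac_eq0 in DF0.
set c := P.[a k] / _; set D := (X in c *: X) in DF0 *.
rewrite -mul_polyC (rmorphM _ c%:P) (rmorphM _ ('X - (a k)%:P)) /=.
by rewrite -mulf_div (divff DF0) mulr1.
Qed.

End PartialFractions.

(** * Telescoping of the Frobenius quotient and distinctness of its poles *)

Lemma lowfact_shift (A : comPzRingType) (z : A) (p l : nat) :
  lowfact z p * \prod_(1 <= i < l.+1) (z + i%:R) =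
  lowfact (z + l%:R) p * \prod_(1 <= i < l.+1) (z - p%:R + i%:R).
Proof.
(* Both products equal (y + 1)_(p + 1). Iterated l times, this makes both sides of the lemma equal
   to (z + l)_(p + l). *)
have step (y : A) : lowfact y p * (y + 1) = lowfact (y + 1) p * (y - p%:R + 1).
  have -> : y - p%:R + 1 = y + 1 - p%:R by ring.
  rewrite /lowfact -big_nat_recr //= big_nat_recl //= subr0 mulrC; congr (_ * _).
  by apply: eq_bigr => i _; rewrite -addn1 natrD; ring.
elim: l => [|l IHl]; first by rewrite !big_geq // addr0.
rewrite !(@big_nat_recr _ _ _ l.+1) //= mulrA IHl mulrAC -natr1 !addrA.
by rewrite step (addrAC z l%:R (- p%:R)) -mulrA [X in _ * X]mulrC.
Qed.

Lemma rmorph_lowfact (A B : pzRingType) (f : {rmorphism A -> B}) (z : A) p :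
  f (lowfact z p) = lowfact (f z) p.
Proof.
by rewrite rmorph_prod; apply: eq_bigr => j _; rewrite rmorphB rmorph_nat.
Qed.

(** Inverting F(z) moves its denominator to the numerator, where [lowfact_shift] trades it and (z)_p
    for (z + l)_p and the denominator of F(z - p), which cancels. *)
Lemma frobenius_quotient (F : fieldType) (z : F) (la : seq nat) (p : nat) :
  (forall i, z - p%:R + i%:R != 0) ->
  lowfact z p * (frobenius_fun (z - p%:R) la / frobenius_fun z la) =
  lowfact (z + (size la)%:R) p *
    \prod_(1 <= i < (size la).+1) (z - p%:R - (part la i)%:R + i%:R) /
    \prod_(1 <= i < (size la).+1) (z - (part la i)%:R + i%:R).
Proof.
move=> z0; rewrite /frobenius_fun !prodf_div invf_div.
have /(canLR (mulfK _)) <- := lowfact_shift z p (size la).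
  by rewrite [in RHS]mulrAC; ring.
by rewrite prodf_seq_neq0; apply/allP => i _; rewrite z0.
Qed.

(** The parts decrease weakly and -i strictly, so two of the values differ by a positive integer up
    to sign, which is nonzero in characteristic 0. *)
Lemma partition_shift_inj (K : fieldType) (charK0 : [pchar K] =i pred0)
    (la : seq nat) (partla : is_partition la) :
  {in index_iota 1 (size la).+1 &,
    injective (fun i => (part la i)%:R - i%:R : K)}.
Proof.
move: partla => /andP[la_sorted _].
have lt_neq i k : (1 <= i < k)%N -> (k <= size la)%N ->
    (part la i)%:R - i%:R != (part la k)%:R - k%:R :> K.
  move=> /andP[i0 ik] kl.
  have geq_trans : transitive geq by move=> ? ? ? /[swap]; apply: leq_trans.
  have ge : (part la k <= part la i)%N.
    by apply: (sorted_leq_nth geq_trans leqnn 0%N la_sorted); rewrite ?inE; lia.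
  rewrite -subr_eq0 (_ : _ - _ = ((part la i - part la k) + (k - i))%:R).
    by rewrite ((pcharf0P K).1 charK0); lia.
  by rewrite natrD natrB // natrB 1?ltnW //; ring.
move=> i k; rewrite !mem_index_iota => ir kr E.
case: (ltngtP i k) => // ik.
  by have /eqP := lt_neq i k ltac:(lia) ltac:(lia).
by have /eqP := lt_neq k i ltac:(lia) ltac:(lia); rewrite E.
Qed.

(** * The quotient as a ratio of polynomials: polynomial part and residues *)

Section ResidueForm.

Variables (K : fieldType) (la : seq nat) (p : nat).

Let a (i : nat) : K := (part la i)%:R - i%:R.
Let P : {poly K} := lowfact ('X + (size la)%:R) p *
  \prod_(1 <= i < (size la).+1) ('X - (a i + p%:R)%:P).
Let Q : {poly K} := \prod_(1 <= i < (size la).+1) ('X - (a i)%:P).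

Lemma frobenius_quotient_frac :
  lowfact (zvar K) p *
    (frobenius_fun (zvar K - p%:R) la / frobenius_fun (zvar K) la) = P%:F / Q%:F.
Proof.
rewrite frobenius_quotient => [|i].
  rewrite rmorphM rmorph_lowfact (rmorphD _ 'X) rmorph_nat !rmorph_prod /=.
  congr (_ * _ / _); apply: eq_bigr => i _.
    by rewrite !(rmorphB, rmorphD, rmorph_nat) /= /zvar; ring.
  by rewrite !(rmorphB, rmorph_nat) /= /zvar opprB addrA addrAC.
rewrite (_ : _ + _ = ('X - (p%:R - i%:R)%:P : {poly K})%:F).
  by rewrite tofrac_eq0 polyXsubC_eq0.
by rewrite !(rmorphB, rmorph_nat) /= opprB addrA addrAC.
Qed.

Lemma size_lowfact_poly (c : K) n : size (lowfact ('X + c%:P) n) = n.+1.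
Proof.
rewrite /lowfact (eq_bigr (fun j => 'X - (j%:R - c)%:P)) => [|j _].
  by rewrite size_prod_XsubC size_iota subn0.
by rewrite rmorphB rmorph_nat opprB addrA.
Qed.

(** The degree of [P] is at most p + l and that of [Q] is l, so the polynomial part only involves
    z^p, ..., z^0. *)
Lemma size_frobenius_quotient : (size (P %/ Q)%R <= p.+1)%N.
Proof.
have Q0 : Q != 0 by rewrite monic_neq0 ?monic_prod_XsubC.
rewrite size_divp // /Q size_prod_XsubC size_iota /=.
have := size_polyMleq (lowfact ('X + (size la)%:R) p)
  (\prod_(1 <= i < (size la).+1) ('X - (a i + p%:R)%:P)).
rewrite -[X in 'X + X](rmorph_nat polyC) size_lowfact_poly.
rewrite (size_prod_XsubC _ (fun i => a i + p%:R)) size_iota rmorph_nat -/P.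
move: (size P) => n; lia.
Qed.

(** At [a k] the factor of index [k] in the product of [P] takes the value -p; the other factors
    match those of [dcoef] one by one. *)
Lemma residue_dcoef k : (1 <= k < (size la).+1)%N ->
  P.[a k] / \prod_(1 <= i < (size la).+1 | i != k) (a k - a i) =
  - (p%:R * dcoef K la k p).
Proof.
move=> kr; have kiota : k \in index_iota 1 (size la).+1 by rewrite mem_index_iota.
(* Evaluation is read as the ring morphism [horner_eval], so that [rmorph_lowfact] applies. *)
rewrite /P hornerM -[_.[_]]/(horner_eval (a k) _) rmorph_lowfact rmorphD.
rewrite rmorph_nat /= /horner_eval hornerX horner_prod.
rewrite (bigD1_seq k) ?iota_uniq //= hornerXsubC opprD addrA subrr add0r.
rewrite /dcoef prodf_div mulrCA !mulNr -!mulrA; congr (- (_ * (_ * (_ / _)))).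
- by rewrite addrAC.
- by apply: eq_bigr => i _; rewrite hornerXsubC /a; ring.
- by apply: eq_bigr => i _; rewrite /a; ring.
Qed.

End ResidueForm.

Theorem theorem1 (K : fieldType) (charK0 : [pchar K] =i pred0)
    (la : seq nat) (partla : is_partition la) (p : nat) (p_gt0 : (0 < p)%N) :
  let f : {fraction {poly K}} :=
    lowfact (zvar K) p *
      (frobenius_fun (zvar K - p%:R) la / frobenius_fun (zvar K) la) in
  (exists C : int -> K, expansion_infty (- p%:Z) f C) /\
  (forall C : int -> K, expansion_infty (- p%:Z) f C ->
    forall r : nat,
      C (r.+1)%:Z =
        - (p%:R * \sum_(1 <= k < (size la).+1)
                    dcoef K la k p * ((part la k)%:R - k%:R) ^+ r)).
Proof.
move=> f; pose a (i : nat) : K := (part la i)%:R - i%:R.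
pose r := index_iota 1 (size la).+1.
(* One explicit expansion [D] gives existence; uniqueness then carries its coefficients over to
   every [C]. *)
have [D [fD Dr]] : exists D : int -> K, expansion_infty (- p%:Z) f D /\
    forall n : nat, D n.+1%:Z = \sum_(k <- r) (- (p%:R * dcoef K la k p)) * a k ^+ n.
  have fE := frobenius_quotient_frac K la p.
  rewrite (partial_fractions (iota_uniq _ _)
    (partition_shift_inj charK0 partla)) in fE.
  rewrite (eq_big_seq (fun k => ((- (p%:R * dcoef K la k p))%:P)%:F
      / ('X - (a k)%:P)%:F)) in fE; last first.
    by move=> k; rewrite mem_index_iota => /residue_dcoef ->.
  have := expansion_inftyD (expansion_poly (size_frobenius_quotient K la p))
    (expansion_infty_sum r (fun k => @expansion_simple_pole _ (- p%:Z)
       (- (p%:R * dcoef K la k p)) (a k) ltac:(lia))).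
  rewrite -fE => fD; eexists; split; first exact: fD.
  (* The polynomial part contributes only at indices -j with j a natural number, never at [n.+1]. *)
  by move=> n /=; rewrite big1 ?add0r // => j _; case: eqP => //; lia.
split=> [|C fC n]; first by exists D.
have -> : C n.+1%:Z = D n.+1%:Z.
  (* Uniqueness counts from the starting index -p, so the offset [p + n.+1] reaches the index
     [n.+1]. *)
  have := expansion_infty_unique fC fD (p + n.+1)%N.
  by rewrite PoszD addrA addNr add0r.
by rewrite Dr mulr_sumr -sumrN; apply: eq_bigr => k _; rewrite mulNr mulrA.
Qed.
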